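(* Let $K$ be an algebraically closed field of characteristic zero, let $L$ be a finite-dimensional Klein graded Lie algebra over $K$ with color map $\theta$, and let $V$ be a finite-dimensional simple graded $L$-module. Then there are $u_r \in \mathrm{Hom}_L(V)_r$, $u_s\in \mathrm{Hom}_L(V)_s$, $u_t\in \mathrm{Hom}_L(V)_t$ such that $$\mathrm{Hom}_L(V)_e = K\,\mathrm{Id},\quad \mathrm{Hom}_L(V)_r = K u_r,\quad \mathrm{Hom}_L(V)_s = K u_s,\quad \mathrm{Hom}_L(V)_t = K u_t,$$ where for each $k\in\{r,s,t\}$ either $u_k = 0$ or $u_k^2 = \mathrm{Id}$.
   Context: Let $\mathcal{K}=\{e,r,s,t\}$ be the Klein four-group with identity $e$. A color map on $\mathcal{K}$ is a map $\theta:\mathcal{K}\times\mathcal{K}\to\mathbb{C}^*$ with $\theta(a,b)\theta(b,a)=1$, $\theta(a,bc)=\theta(a,b)\theta(a,c)$, $\theta(ab,c)=\theta(a,c)\theta(b,c)$; it necessarily takes values in $\{1,-1\}$, which are regarded as elements of $K$. A Klein graded Lie algebra is a $\mathcal{K}$-graded vector space $L = L_e\oplus L_r\oplus L_s\oplus L_t$ with a bilinear bracket satisfying $[L_a,L_b]\subset L_{ab}$, $[A,B]=-\theta(a,b)[B,A]$ and $\theta(a,c)[A,[B,C]]+\theta(a,b)[B,[C,A]]+\theta(b,c)[C,[A,B]]=0$ for $A\in L_a$, $B\in L_b$, $C\in L_c$. A graded $L$-module is a $\mathcal{K}$-graded vector space $V=\bigoplus_{k\in\mathcal{K}} V_k$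 with a bilinear action satisfying $L_g V_h\subset V_{gh}$ and $[A,B]v = A(Bv)-\theta(a,b)B(Av)$ for $A\in L_a$, $B\in L_b$, $v\in V$. It is simple if it is nonzero and its only graded submodules are $0$ and $V$. For $k\in\mathcal{K}$, $\mathrm{Hom}_L(V)_k$ denotes the space of linear maps $f:V\to V$ with $f(V_b)\subset V_{kb}$ for all $b\in\mathcal{K}$ and $f(Av)=\theta(k,a)\,A f(v)$ for all $A\in L_a$, $a\in\mathcal{K}$, $v\in V$. *)

(* Defs.v *)
From HB Require Import structures.
From mathcomp Require Import all_boot all_order all_algebra all_fingroup.
From mathcomp Require Import complex reals.

Set Implicit Arguments.
Unset Strict Implicit.
Unset Printing Implicit Defensive.

Import GRing.Theory.
Local Open Scope ring_scope.

Inductive klein : Type := Ke | Kr | Ks | Kt.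

(* This bijection only provides the finType structure; the group law is
   klein_mul below. *)
Definition klein_code (a : klein) : bool * bool :=
  match a with
  | Ke => (false, false) | Kr => (true, false)
  | Ks => (false, true) | Kt => (true, true)
  end.

Definition klein_decode (p : bool * bool) : klein :=
  match p with
  | (false, false) => Ke | (true, false) => Kr
  | (false, true) => Ks | (true, true) => Kt
  end.

Lemma klein_codeK : cancel klein_code klein_decode.
Proof. by case. Qed.

HB.instance Definition _ := Finite.copy klein (can_type klein_codeK).

Definition klein_mul (a b : klein) : klein :=
  match a, b with
  | Ke, c | c, Ke => c
  | Kr, Kr | Ks, Ks | Kt, Kt => Ke
  | Kr, Ks | Ks, Kr => Kt
  | Kr, Kt | Kt, Kr => Ks
  | Ks, Kt | Kt, Ks => Kr
  end.

Lemma klein_mulA : associative klein_mul.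
Proof. by do 3!case. Qed.

Lemma klein_mul1 : left_id Ke klein_mul.
Proof. by case. Qed.

Lemma klein_mulV : left_inverse Ke id klein_mul.
Proof. by case. Qed.

HB.instance Definition _ :=
  Finite_isGroup.Build klein klein_mulA klein_mul1 klein_mulV.

Section ColorMap.

Variable F : fieldType.

Record color_map (theta : klein -> klein -> F) : Prop := ColorMap {
  color_neq0 : forall a b, theta a b != 0;
  color_anti : forall a b, theta a b * theta b a = 1;
  color_mulr : forall a b c, theta a (b * c)%g = theta a b * theta a c;
  color_mull : forall a b c, theta (a * b)%g c = theta a c * theta b c
}.

Lemma color_map_sign (theta : klein -> klein -> F) : color_map theta ->
  forall a b, theta a b = 1 \/ theta a b = -1.
Proof.
move=> th a b.
have th1 : theta Ke b = 1.
  apply: (mulfI (color_neq0 th Ke b)).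
  by rewrite -(color_mull th) mulr1.
have : theta a b ^+ 2 == 1.
  rewrite expr2 -(color_mull th).
  by have -> : (a * a)%g = Ke; [case: (a) | rewrite th1].
by rewrite sqrf_eq1 => /orP[] /eqP ->; [left | right].
Qed.

End ColorMap.

(* The element 1 or -1 of K with the same sign as z; only meant for z = 1 or
   z = -1, which by color_map_sign covers every value of a color map. *)
Definition sign_in (K : fieldType) (C : fieldType) (z : C) : K :=
  if z == 1 then 1 else -1.
Arguments sign_in K {C} z.

Section KleinGraded.

Variables (K : fieldType) (C : fieldType) (theta : klein -> klein -> C).

Local Notation th a b := (sign_in K (theta a b)).

Definition grading (V : vectType K) (V_ : klein -> {vspace V}) : Prop :=
  directv (\sum_k V_ k) /\ (\sum_k V_ k)%VS = fullv.

Record klein_lie (L : vectType K) (L_ : klein -> {vspace L})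
    (br : {bilinear L -> L -> L}) : Prop := KleinLie {
  klein_lie_grading : grading L_;
  klein_lie_deg : forall (a b : klein) (A B : L),
    A \in L_ a -> B \in L_ b -> br A B \in L_ (a * b)%g;
  klein_lie_anti : forall (a b : klein) (A B : L),
    A \in L_ a -> B \in L_ b -> br A B = - (th a b *: br B A);
  klein_lie_jacobi : forall (a b c : klein) (A B D : L),
    A \in L_ a -> B \in L_ b -> D \in L_ c ->
    th a c *: br A (br B D) + th a b *: br B (br D A)
      + th b c *: br D (br A B) = 0
}.

Section Modules.

Variables (L : vectType K) (L_ : klein -> {vspace L}).
Variables (br : {bilinear L -> L -> L}).
Variables (V : vectType K) (V_ : klein -> {vspace V}).
Variables (act : {bilinear L -> V -> V}).

Record graded_module : Prop := GradedModule {
  graded_module_grading : grading V_;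
  graded_module_deg : forall (g h : klein) (A : L) (v : V),
    A \in L_ g -> v \in V_ h -> act A v \in V_ (g * h)%g;
  graded_module_bracket : forall (a b : klein) (A B : L) (v : V),
    A \in L_ a -> B \in L_ b ->
    act (br A B) v = act A (act B v) - th a b *: act B (act A v)
}.

Definition graded_submodule (W : {vspace V}) : Prop :=
  (\sum_k (W :&: V_ k))%VS = W /\
  (forall (A : L) (w : V), w \in W -> act A w \in W).

Definition simple_graded_module : Prop :=
  [/\ graded_module,
      (fullv : {vspace V}) <> 0%VS &
      forall W : {vspace V}, graded_submodule W -> W = 0%VS \/ W = fullv].

Definition graded_hom (k : klein) (f : 'End(V)) : Prop :=
  (forall (b : klein) (v : V), v \in V_ b -> f v \in V_ (k * b)%g) /\
  (forall (a : klein) (A : L) (v : V),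
     A \in L_ a -> f (act A v) = th k a *: act A (f v)).

End Modules.

End KleinGraded.

(* Main.v *)
Require Import Defs.
From HB Require Import structures.
From mathcomp Require Import all_boot all_order all_algebra all_fingroup.
From mathcomp Require Import complex reals.
From mathcomp Require Import boolp.

Set Implicit Arguments.
Unset Strict Implicit.
Unset Printing Implicit Defensive.

Import GRing.Theory.
Local Open Scope ring_scope.

(** This is Schur's lemma, carried out degree by degree.

    A homogeneous endomorphism commutes with the action up to signs, and signs
    do not affect kernels; homogeneity makes the kernel compatible with the
    grading.  So its kernel is a graded submodule ([graded_submodule_ker]), and
    when V is simple a nonzero homogeneous endomorphism is injective
    ([simple_graded_hom_inj]).

    In degree e, the color map is trivial, so subtracting a scalar keeps an
    endomorphism in the graded homomorphisms of degree e.  Over an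
    algebraically closed field there is an eigenvalue, and subtracting it gives
    a non-injective element, hence zero: Hom_L(V)_e = K Id
    ([simple_graded_hom_Ke]).

    Every k in the Klein group squares to e and every sign squares to 1, so two
    elements of Hom_L(V)_k compose to an element of Hom_L(V)_e, that is, to a
    scalar ([graded_hom_comp]).  A nonzero f of degree k is injective, so f^2 is
    a nonzero scalar, and dividing f by a square root of it gives u with
    u^2 = Id.  Then any g of degree k equals u (u g), a scalar multiple
    of u ([simple_graded_hom_line]). *)

(** * Eigenvalues of endomorphisms *)

Lemma closed_lker_shift (K : closedFieldType) (V : vectType K) (f : 'End(V)) :
  (fullv : {vspace V}) <> 0%VS -> exists a : K, lker (f - a *: \1%VF) <> 0%VS.
Proof.
move=> V_neq0; set A := passmx.mxof (vbasis fullv) (vbasis fullv) f.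
have /closed_rootP[a rAa] : size (char_poly A) != 1%N.
  by rewrite size_char_poly eqSS dimv_eq0; apply/eqP.
exists a; apply/eqP; rewrite -[lker _]/(passmx.leigenspace f a).
have bV := vbasisP (fullv : {vspace V}).
rewrite (passmx.leigenspaceE bV) passmx.vsof_eq0 // -/A.
by rewrite -eigenvalue_root_char in rAa.
Qed.

(** * Signs of a color map *)

Section Signs.

Variables (K C : fieldType) (theta : klein -> klein -> C).

Lemma sign_in_sqr (z : C) : sign_in K z * sign_in K z = 1.
Proof. by rewrite /sign_in; case: ifP => _; rewrite ?mulrNN mulr1. Qed.

Lemma color_Ke_l (theta_color : color_map theta) a : theta Ke a = 1.
Proof.
apply: (mulfI (color_neq0 theta_color Ke a)).
by rewrite -(color_mull theta_color) mulr1.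
Qed.

End Signs.

Lemma klein_mulKg (k : klein) : cancel (mulg k) (mulg k).
Proof. by case: k => -[]. Qed.

Lemma grading_decomp (K : fieldType) (V : vectType K)
    (V_ : klein -> {vspace V}) (v : V) : grading V_ ->
  exists2 v_ : klein -> V, forall k, v_ k \in V_ k & v = \sum_k v_ k.
Proof.
case=> _ sumV; have /memv_sumP[v_ Vv ->] : v \in (\sum_k V_ k)%VS.
  by rewrite sumV memvf.
by exists v_ => // k; apply: Vv.
Qed.

(** * Graded homomorphisms *)

Section GradedHom.

Variables (K C : fieldType) (theta : klein -> klein -> C).
Variables (L : vectType K) (L_ : klein -> {vspace L}).
Variables (V : vectType K) (V_ : klein -> {vspace V}).
Variables (act : {bilinear L -> V -> V}).

Local Notation hom := (graded_hom theta L_ V_ act).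

Lemma graded_hom0 k : hom k 0.
Proof.
split=> [b v _ | a A v _]; first by rewrite lfunE mem0v.
by rewrite !lfunE linear0r scaler0.
Qed.

Lemma graded_homZ k c f : hom k f -> hom k (c *: f).
Proof.
move=> [f_deg f_act]; split=> [b v Vv | a A v LA].
  by rewrite lfunE memvZ ?f_deg.
by rewrite !lfunE /= (f_act a) // linearZr !scalerA mulrC.
Qed.

Lemma graded_homB k f g : hom k f -> hom k g -> hom k (f - g).
Proof.
move=> [f_deg f_act] [g_deg g_act]; split=> [b v Vv | a A v LA].
  by rewrite add_lfunE opp_lfunE memvB ?f_deg ?g_deg.
rewrite !add_lfunE !opp_lfunE (f_act a) // (g_act a) //.
by rewrite linearBr scalerBr.
Qed.

(** Both factors contribute the same sign, whose square is 1, and k * k = e: the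
    composite has degree e and commutes with the action outright. *)
Lemma graded_hom_comp (theta_color : color_map theta) k f g :
  hom k f -> hom k g -> hom Ke (f \o g)%VF.
Proof.
move=> [f_deg f_act] [g_deg g_act]; split=> [b v Vv | a A v LA].
  by rewrite comp_lfunE mul1g -[b](klein_mulKg k); apply/f_deg/g_deg.
rewrite !comp_lfunE (g_act a) // linearZ /= (f_act a) // scalerA.
by rewrite sign_in_sqr color_Ke_l // /sign_in eqxx.
Qed.

Lemma graded_hom1 (theta_color : color_map theta) : hom Ke \1%VF.
Proof.
split=> [b v Vv | a A v _]; first by rewrite id_lfunE mul1g.
by rewrite !id_lfunE color_Ke_l // /sign_in eqxx scale1r.
Qed.

(** f maps distinct homogeneous components into distinct ones, so a vector is
    killed by f only if each of its components is. *)
Lemma graded_submodule_ker k f : grading L_ -> grading V_ -> hom k f ->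
  graded_submodule V_ act (lker f).
Proof.
move=> L_grad V_grad [f_deg f_act]; split=> [|A w]; last first.
  rewrite !memv_ker => /eqP fw0.
  have [A_ LA ->] := grading_decomp A L_grad.
  rewrite linear_sumlz linear_sum big1 //= => a _.
  by rewrite (f_act a) ?LA // fw0 linear0r scaler0.
apply/eqP; rewrite eqEsubv; apply/andP; split.
  by apply/subv_sumP => b _; apply: capvSl.
apply/subvP=> w; rewrite memv_ker => /eqP fw0.
have [w_ Vw def_w] := grading_decomp w V_grad.
(* The component of f w in degree b comes from that of w in degree k * b. *)
have fw_comp0 b : f (w_ (k * b)%g) = 0.
  have [/directv_sum_independent indep _] := V_grad.
  apply: (indep (fun b => f (w_ (k * b)%g))) => // [c _ |].
    by rewrite -{2}[c](klein_mulKg k); apply: f_deg.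
  have <- := reindex_inj (mulgI k) (P := xpredT) (F := fun c => f (w_ c)).
  by rewrite -linear_sum -def_w.
rewrite def_w; apply: memv_sumr => b _.
by rewrite memv_cap Vw memv_ker -[b](klein_mulKg k) fw_comp0 eqxx.
Qed.

End GradedHom.

(** * Schur's lemma *)

Section Schur.

Variables (K : closedFieldType) (C : fieldType) (theta : klein -> klein -> C).
Hypothesis theta_color : color_map theta.
Variables (L : vectType K) (L_ : klein -> {vspace L}).
Variables (br : {bilinear L -> L -> L}).
Hypothesis L_grad : grading L_.
Variables (V : vectType K) (V_ : klein -> {vspace V}).
Variables (act : {bilinear L -> V -> V}).
Hypothesis V_simple : simple_graded_module theta L_ br V_ act.

Local Notation hom := (graded_hom theta L_ V_ act).

Lemma simple_graded_hom_inj k f : hom k f -> f = 0 \/ lker f = 0%VS.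
Proof.
have [[V_grad _ _] _ V_sub] := V_simple.
move=> hf; have [-> | kerT] := V_sub _ (graded_submodule_ker L_grad V_grad hf).
  by right.
by left; apply/lfunP=> v; apply/eqP; rewrite zero_lfunE -memv_ker kerT memvf.
Qed.

Lemma simple_graded_hom_Ke f : hom Ke f -> exists a, f = a *: \1%VF.
Proof.
move=> hf; have [_ V_neq0 _] := V_simple.
have [a ker_neq0] := closed_lker_shift f V_neq0.
have hg := graded_homB hf (graded_homZ a (graded_hom1 L_ V_ act theta_color)).
have [/eqP | //] := simple_graded_hom_inj hg.
by rewrite subr_eq0 => /eqP; exists a.
Qed.

Lemma closed_sqrt (a : K) : exists b : K, b * b = a.
Proof.
have [b] := @solve_monicpoly K 2 (fun i => if i is 0%N then a else 0) isT.
by rewrite !big_ord_recl big_ord0 /= mulr1 mul0r !addr0 expr2; exists b.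
Qed.

(** The span of any normalized nonzero u exhausts degree k, because u is its own
    inverse and u g is a scalar for each g of degree k. *)
Lemma simple_graded_hom_line k : exists u : 'End(V),
  [/\ hom k u, forall f, hom k f <-> f \in <[u]>%VS &
      u = 0 \/ (u \o u)%VF = \1%VF].
Proof.
have line_hom u : hom k u -> forall f, f \in <[u]>%VS -> hom k f.
  by move=> hu f /vlineP[c ->]; apply: graded_homZ.
have [[f [hf f_neq0]] | no_hom] := pselect (exists f, hom k f /\ f <> 0).
  have [a def_ff] := simple_graded_hom_Ke (graded_hom_comp theta_color hf hf).
  have [b def_a] := closed_sqrt a.
  (* f is injective, so f^2 = b^2 Id cannot vanish on the nonzero space V. *)
  have b_neq0 : b != 0.
    apply/eqP => b0; apply: f_neq0.
    have [// | /eqP/lker0P f_inj] := simple_graded_hom_inj hf.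
    apply/lfunP=> v; rewrite zero_lfunE; apply/f_inj/f_inj.
    by rewrite -comp_lfunE def_ff -def_a b0 mul0r scale0r !(zero_lfunE, linear0).
  have hu := graded_homZ b^-1 hf.
  have uu : ((b^-1 *: f) \o (b^-1 *: f))%VF = \1%VF.
    rewrite -comp_lfunZl -comp_lfunZr def_ff -def_a !scalerA.
    by rewrite -!mulrA mulKf ?mulVf ?scale1r.
  exists (b^-1 *: f); split=> // [g|]; last by right.
  split=> [hg | ]; last exact: line_hom.
  have [c def_ug] := simple_graded_hom_Ke (graded_hom_comp theta_color hu hg).
  apply/vlineP; exists c.
  by rewrite -[LHS]comp_lfun1l -uu -comp_lfunA def_ug -comp_lfunZr comp_lfun1r.
have h0 := graded_hom0 theta L_ V_ act k.
exists 0; split=> // [g|]; last by left.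
split=> [hg | ]; last exact: line_hom.
have [-> | /eqP g_neq0] := eqVneq g 0; first exact: mem0v.
by case: no_hom; exists g.
Qed.

End Schur.

Theorem lemma7p11 (R : realType) (K : closedFieldType)
    (charK : [pchar K] =i pred0)
    (theta : klein -> klein -> R[i]) (theta_color : color_map theta)
    (L : vectType K) (L_ : klein -> {vspace L}) (br : {bilinear L -> L -> L})
    (L_lie : klein_lie theta L_ br)
    (V : vectType K) (V_ : klein -> {vspace V}) (act : {bilinear L -> V -> V})
    (V_simple : simple_graded_module theta L_ br V_ act) :
  exists u_r u_s u_t : 'End(V),
    [/\ graded_hom theta L_ V_ act Kr u_r,
        graded_hom theta L_ V_ act Ks u_s &
        graded_hom theta L_ V_ act Kt u_t] /\
    [/\ forall f, graded_hom theta L_ V_ act Ke f <-> f \in <[\1%VF]>%VS,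
        forall f, graded_hom theta L_ V_ act Kr f <-> f \in <[u_r]>%VS,
        forall f, graded_hom theta L_ V_ act Ks f <-> f \in <[u_s]>%VS &
        forall f, graded_hom theta L_ V_ act Kt f <-> f \in <[u_t]>%VS] /\
    [/\ u_r = 0 \/ (u_r \o u_r)%VF = \1%VF,
        u_s = 0 \/ (u_s \o u_s)%VF = \1%VF &
        u_t = 0 \/ (u_t \o u_t)%VF = \1%VF].
Proof.
have line := simple_graded_hom_line theta_color (klein_lie_grading L_lie)
               V_simple.
have [u_r [hr lr sr]] := line Kr.
have [u_s [hs ls ss]] := line Ks.
have [u_t [ht lt st]] := line Kt.
exists u_r, u_s, u_t; split=> //; split=> //; split=> // f; split.
  move=> hf; apply/vlineP.
  exact: (simple_graded_hom_Ke theta_color (klein_lie_grading L_lie) V_simple hf).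
by move=> /vlineP[c ->]; apply/graded_homZ/graded_hom1.
Qed.
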